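(* Consider the two-stage linear adaptive robust optimization problem (P) described in the context, and let $\mathcal{X}\subseteq\mathbb{R}^{n_x}$ be its set of adaptive robustly feasible Stage-1 decisions. If $\mathcal{X}$ is compact, then there exists a Stage-1 decision $\bm{x}$ that is Pareto Adaptive Robustly Optimal (PARO) to (P).
   Context: Problem (P): $\min_{\bm{x},\bm{y}(\cdot)}\max_{\bm{z}\in U}\ \bm{c}(\bm{z})^{\top}\bm{x}+\bm{d}^{\top}\bm{y}(\bm{z})$ subject to $\bm{A}(\bm{z})\bm{x}+\bm{B}\bm{y}(\bm{z})\le \bm{r}(\bm{z})$ for all $\bm{z}\in U$. Here $U\subseteq\mathbb{R}^L$ is compact and convex with nonempty relative interior; $\bm{x}\in\mathbb{R}^{n_x}$ (Stage-1 decision); $\bm{y}\in\mathcal{R}^{L,n_y}$ (Stage-2 decision rule), where $\mathcal{R}^{L,n_y}$ is the set of measurable functions $\mathbb{R}^L\to\mathbb{R}^{n_y}$ that are bounded on compact sets; $\bm{B}\in\mathbb{R}^{m\times n_y}$ and $\bm{d}\in\mathbb{R}^{n_y}$ are constant; $\bm{A}(\bm{z})\in\mathbb{R}^{m\times n_x}$, $\bm{r}(\bm{z})\in\mathbb{R}^m$, $\bm{c}(\bm{z})\in\mathbb{R}^{n_x}$ depend affinely on $\bm{z}$. A pair $(\bm{x},\bm{y}(\cdot))$ is adaptive robustly feasible (ARF) if it satisfies all constraints of (P); $\bm{x}$ is ARF if some $\bm{y}(\cdot)\in\mathcal{R}^{L,n_y}$ makes $(\bm{x},\bm{y}(\cdot))$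 ARF, and $\mathcal{X}$ is the set of ARF $\bm{x}$. $\mathrm{OPT}$ is the optimal (worst-case) value of (P). Standing assumptions: $\mathcal{X}\ne\emptyset$ and $\mathrm{OPT}$ is finite. A pair is adaptive robustly optimal (ARO) if it is ARF and $\bm{c}(\bm{z})^{\top}\bm{x}+\bm{d}^{\top}\bm{y}(\bm{z})\le\mathrm{OPT}$ for all $\bm{z}\in U$. A pair $(\bm{x},\bm{y}(\cdot))$ is PARO if it is ARO and there is no ARO pair $(\bar{\bm{x}},\bar{\bm{y}}(\cdot))$ with $\bm{c}(\bm{z})^{\top}\bar{\bm{x}}+\bm{d}^{\top}\bar{\bm{y}}(\bm{z})\le \bm{c}(\bm{z})^{\top}\bm{x}+\bm{d}^{\top}\bm{y}(\bm{z})$ for all $\bm{z}\in U$ and with strict inequality for some $\bar{\bm{z}}\in U$. A Stage-1 decision $\bm{x}$ is PARO if there exists $\bm{y}(\cdot)$ such that $(\bm{x},\bm{y}(\cdot))$ is PARO. *)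

(* Defs.v *)
From HB Require Import structures.
From mathcomp Require Import all_boot all_order all_algebra.
From mathcomp Require Import all_classical all_reals all_analysis.

Set Implicit Arguments.
Unset Strict Implicit.
Unset Printing Implicit Defensive.

Import Order.TTheory GRing.Theory Num.Theory.
Import numFieldNormedType.Exports.

Local Open Scope classical_set_scope.
Local Open Scope ring_scope.

Section general_notions.
Variable R : realType.

Definition affine_map (V W : lmodType R) (f : V -> W) : Prop :=
  exists (g : {linear V -> W}) (b : W), forall v, f v = g v + b.

Definition affine_hull (V : lmodType R) (A : set V) : set V :=
  [set v | exists n (p : 'I_n -> V) (t : 'I_n -> R),
     [/\ forall i, A (p i), \sum_i t i = 1 & v = \sum_i t i *: p i]].

Definition relative_interior (V : normedModType R) (A : set V) : set V :=
  [set v | A v /\ \forall w \near v, affine_hull A w -> A w].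

(* Column vectors equipped with the Borel sigma-algebra of their topology. *)
Definition borel_cV (n : nat) := g_sigma_algebraType (@open 'cV[R]_n).

Definition decision_rule (L n : nat) : set ('cV[R]_L -> 'cV[R]_n) :=
  [set y | measurable_fun [set: borel_cV L] (y : borel_cV L -> borel_cV n) /\
           forall K : set 'cV[R]_L, compact K -> bounded_set (y @` K)].

Definition le_cV (n : nat) (u v : 'cV[R]_n) : Prop :=
  forall i, u i 0 <= v i 0.

Definition dotcV (n : nat) (u v : 'cV[R]_n) : R := (u^T *m v) 0 0.

End general_notions.

(* Data of
     min_{x, y(.)} max_{z in U} c(z)^T x + d^T y(z)
     s.t. A(z) x + B y(z) <= r(z) for all z in U. *)
Record problem (R : realType) (L nx ny m : nat) := Problem {
  pU : set 'cV[R]_L ;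
  pA : 'cV[R]_L -> 'M[R]_(m, nx) ;
  pB : 'M[R]_(m, ny) ;
  pr : 'cV[R]_L -> 'cV[R]_m ;
  pc : 'cV[R]_L -> 'cV[R]_nx ;
  pd : 'cV[R]_ny }.

Section adaptive_robust_optimization.
Variables (R : realType) (L nx ny m : nat) (P : problem R L nx ny m).
Implicit Types (x : 'cV[R]_nx) (y : 'cV[R]_L -> 'cV[R]_ny) (z : 'cV[R]_L).

Definition objective x y z : R := dotcV (pc P z) x + dotcV (pd P) (y z).

Definition ARF x y : Prop :=
  decision_rule y /\
  forall z, pU P z -> le_cV (pA P z *m x + pB P *m y z) (pr P z).

Definition ARF_stage1 : set 'cV[R]_nx := [set x | exists y, ARF x y].

Definition worst_case x y : \bar R :=
  ereal_sup [set (objective x y z)%:E | z in pU P].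

Definition OPT : \bar R :=
  ereal_inf [set v | exists x y, ARF x y /\ v = worst_case x y].

Definition ARO x y : Prop :=
  ARF x y /\ forall z, pU P z -> ((objective x y z)%:E <= OPT)%E.

Definition PARO x y : Prop :=
  ARO x y /\
  ~ exists x' y', [/\ ARO x' y',
      forall z, pU P z -> objective x' y' z <= objective x y z &
      exists2 z, pU P z & objective x' y' z < objective x y z].

Definition PARO_stage1 : set 'cV[R]_nx := [set x | exists y, PARO x y].

End adaptive_robust_optimization.

(* Main.v *)
Require Import Defs.
From HB Require Import structures.
From mathcomp Require Import all_boot all_order all_algebra.
From mathcomp Require Import all_classical all_reals all_analysis.
From mathcomp Require Import lra.

(* For fixed x and z the best recourse is a linear program in y with right-hand
   side b = r(z) - A(z) x. Finiteness of OPT excludes cost-decreasing recession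
   directions, so the optimum of this program is attained at one of finitely
   many solutions that are linear in b; choosing the cheapest feasible one gives
   a Borel decision rule, bounded on U. The resulting value g(x, z) has closed
   sublevel sets in x on the compact set X. By compactness some x in X has
   g(x, .) <= OPT, and by Zorn's lemma there is an x below it that is minimal for
   the pointwise order on g(x, .); this x with its optimal recourse is PARO. *)

Set Implicit Arguments.
Unset Strict Implicit.
Unset Printing Implicit Defensive.

Import Order.TTheory GRing.Theory Num.Theory.
Import numFieldNormedType.Exports.

Local Open Scope classical_set_scope.
Local Open Scope ring_scope.

(** * Linear programs and their basic solutions *)

Section linear_programs.
Variables (R : realType) (m n : nat).
Implicit Types (B : 'M[R]_(m, n)) (b : 'cV[R]_m) (d y w : 'cV[R]_n) (S : {set 'I_m}).

Lemma dotcVD d y w : dotcV d (y + w) = dotcV d y + dotcV d w.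
Proof. by rewrite /dotcV mulmxDr mxE. Qed.

Lemma dotcVZ d (t : R) y : dotcV d (t *: y) = t * dotcV d y.
Proof. by rewrite /dotcV -scalemxAr mxE. Qed.

Lemma dotcVN d y : dotcV d (- y) = - dotcV d y.
Proof. by rewrite -scaleN1r dotcVZ mulN1r. Qed.

Definition row_mask (S : {set 'I_m}) : 'M[R]_m := diag_mx (\row_i (i \in S)%:R).

Lemma row_maskE S k (A : 'M[R]_(m, k)) i j :
  (row_mask S *m A) i j = (i \in S)%:R * A i j.
Proof. by rewrite mul_diag_mx !mxE. Qed.

(* [pinvmx] solves row systems, hence the transposes; masking the rows outside
   [S] avoids a dependence of the matrix type on [S]. *)
Definition basic_sol B (S : {set 'I_m}) : 'M[R]_(n, m) :=
  (pinvmx (row_mask S *m B)^T)^T *m row_mask S.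

(** The vector [y] only witnesses that the rows in [S] form a consistent system; a pseudo-inverse
    solves every consistent system. *)
Lemma basic_solP B S b y :
  (forall i, i \in S -> (B *m y) i 0 = b i 0) ->
  forall i, i \in S -> (B *m (basic_sol B S *m b)) i 0 = b i 0.
Proof.
move=> By.
have e : row_mask S *m b = row_mask S *m B *m y.
  apply/colP => i; rewrite -mulmxA !row_maskE.
  by case: (boolP (i \in S)) => [/By ->//|_]; rewrite !mul0r.
suff e2 : row_mask S *m (B *m (basic_sol B S *m b)) = row_mask S *m b.
  by move=> i iS; have /colP/(_ i) := e2; rewrite !row_maskE iS !mul1r.
rewrite /basic_sol -(mulmxA _ (row_mask S)) mulmxA e; set C := row_mask S *m B.
apply: trmx_inj; rewrite [LHS]trmx_mul [X in X *m _]trmx_mul trmxK mulmxKpV//.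
by rewrite trmx_mul submxMl.
Qed.

Definition active B b y : {set 'I_m} := [set i | (B *m y) i 0 == b i 0].

(** As in the simplex method, the step length is the least ratio of slack to slope over the rows
    that increase along [w]; the row attaining it becomes active, and the active rows are constant
    along [w]. *)
Lemma ratio_test B b y w :
  le_cV (B *m y) b ->
  (forall i, i \in active B b y -> (B *m w) i 0 = 0) ->
  ~ le_cV (B *m w) 0 ->
  exists t : R, [/\ 0 <= t, le_cV (B *m (y + t *: w)) b &
    active B b y \proper active B b (y + t *: w)].
Proof.
move=> By Bw nBw.
have [i0 Hi0] : exists i, 0 < (B *m w) i 0.
  apply: contrapT => H; apply: nBw => i; rewrite [leRHS]mxE leNgt.
  by apply/negP => Hi; apply: H; exists i.
pose q i := (b i 0 - (B *m y) i 0) / (B *m w) i 0.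
case: (@Order.TotalTheory.arg_minP _ _ _ i0 (fun i => 0 < (B *m w) i 0) q Hi0) => k Hk kmin.
have q0 i : 0 < (B *m w) i 0 -> 0 <= q i.
  by move=> Hi; rewrite divr_ge0 ?(ltW Hi)// subr_ge0.
have E i : (B *m (y + q k *: w)) i 0 = (B *m y) i 0 + q k * (B *m w) i 0.
  by rewrite mulmxDr -scalemxAr [LHS]mxE [X in _ + X]mxE.
exists (q k); split; first exact: q0.
- move=> i; rewrite E.
  have [Hi|Hi] := ltP 0 ((B *m w) i 0).
    by rewrite -lerBrDl -ler_pdivlMr// kmin.
  by rewrite -lerBrDl (@le_trans _ _ 0) ?subr_ge0// mulr_ge0_le0// q0.
- apply/properP; split.
    apply/fintype.subsetP => i /[dup] /Bw Bwi; rewrite !inE => /eqP Hi.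
    by rewrite E Bwi mulr0 addr0 Hi.
  exists k; rewrite !inE.
    by rewrite E divfK ?subrKC// gt_eqF.
  by apply/negP => /eqP Hi; move: Hk; rewrite Bw ?ltxx// inE Hi.
Qed.

(* From a feasible [y], move along the line towards [basic_sol B S *m b], for [S]
   the active set of [y], or away from it if that is cheaper: either this
   solution is reached or a new constraint becomes active, since [dual] rules
   out a cost-decreasing ray. *)
Lemma basic_sol_opt B b d y :
  (forall w, le_cV (B *m w) 0 -> 0 <= dotcV d w) ->
  le_cV (B *m y) b ->
  exists S, le_cV (B *m (basic_sol B S *m b)) b /\
            dotcV d (basic_sol B S *m b) <= dotcV d y.
Proof.
move=> dual.
(* Induction on the number of inactive constraints, which each ratio test lowers. *)
have [k] := ubnP (m - #|active B b y|)%N; elim: k y => // k IH y.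
rewrite ltnS => Hk By.
pose S := active B b y; pose y' := basic_sol B S *m b.
have Sy i : i \in S -> (B *m y) i 0 = b i 0 by rewrite inE => /eqP.
have Sw i : i \in S -> (B *m (y' - y)) i 0 = 0.
  by move=> iS; rewrite mulmxBr mxE [X in _ + X]mxE (basic_solP Sy)// Sy// subrr.
have step w : (forall i, i \in S -> (B *m w) i 0 = 0) ->
    ~ le_cV (B *m w) 0 -> dotcV d w <= 0 ->
  exists S, le_cV (B *m (basic_sol B S *m b)) b /\
            dotcV d (basic_sol B S *m b) <= dotcV d y.
  move=> Hw nw dw; have [t [t0 Bt /proper_card St]] := ratio_test By Hw nw.
  have Sm : (#|active B b (y + t *: w)| <= m)%N by rewrite -[X in (_ <= X)%N]card_ord max_card.
  have [|//|T [HT dT]] := IH (y + t *: w).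
    by apply: leq_trans Hk; rewrite ltn_sub2l// (leq_trans St).
  exists T; split=> //; apply: (le_trans dT).
  by rewrite dotcVD dotcVZ gerDl mulr_ge0_le0.
have [dw|dw] := leP (dotcV d (y' - y)) 0.
  have [wf|nwf] := pselect (le_cV (B *m y') b).
    exists S; split=> //; rewrite -/y' -subr_le0 -dotcVN -dotcVD//.
  (* If [y' - y] were a recession direction, [y'] would inherit feasibility from [y]. *)
  apply: (step (y' - y)) => // H; apply: nwf => i.
  have := H i; rewrite mulmxBr !mxE subr_le0 => /le_trans; apply.
  by have := By i; rewrite mxE.
apply: (step (- (y' - y))).
- by move=> i iS; rewrite mulmxN mxE Sw// oppr0.
- by move=> /dual; rewrite dotcVN oppr_ge0 leNgt dw.
- by rewrite dotcVN oppr_le0 ltW.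
Qed.

End linear_programs.

(** * Minimax and Pareto-minimal points on a compact set *)

Section compact_orders.
Variables (R : realType) (T : topologicalType).

(** The chain is a base of a proper filter; a cluster point of it in [K] lies in each member, the
    members being closed. *)
Lemma compact_chain (K : set T) (C : set (set T)) :
  compact K -> C !=set0 ->
  (forall A B, C A -> C B -> A `<=` B \/ B `<=` A) ->
  (forall A, C A -> [/\ closed A, A `<=` K & A !=set0]) ->
  exists x, forall A, C A -> A x.
Proof.
move=> cK [A0 CA0] Ctot CP.
have FF : ProperFilter (filter_from C id).
  apply: filter_from_proper; last by move=> A /CP[].
  apply: filter_from_filter; first by exists A0.
  move=> A B CA CB; have [AB|BA] := Ctot _ _ CA CB.
    by exists A => // x Ax; split => //; exact: AB.
  by exists B => // x Bx; split => //; exact: BA.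
have [|x [_ clx]] := cK _ FF; first by exists A0 => //; case: (CP _ CA0).
exists x => A CA; have [clA _ _] := CP _ CA; apply: clA => V Vx.
by apply: clx => //; exists A.
Qed.

Variables (J : Type) (g : T -> J -> R) (K : set T).
Hypotheses (compactK : compact K)
  (closedK : forall i t, closed (K `&` [set x | g x i <= t])).

(** The index supplies at least one closed set to intersect: for empty [J] the set would be [K], and
    [T] is not assumed Hausdorff. *)
Let closed_dom (h : J -> R) : J -> closed (K `&` [set x | forall i, g x i <= h i]).
Proof.
move=> i0.
have -> : K `&` [set x | forall i, g x i <= h i] =
    \bigcap_i (K `&` [set x | g x i <= h i]).
  apply/seteqP; split=> [x [Kx gx] i _|x gx]; first by split; last exact: gx.
  by split=> [|i]; [have [] := gx i0 Logic.I | have [] := gx i Logic.I].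
by apply: closed_bigI => i _; exact: closedK.
Qed.

(** The sublevel sets at heights [t > v] form a chain of nonempty closed sets, and a common point
    satisfies the bound at [v] itself. *)
Lemma compact_minimax_attained (v : R) :
  (forall t, v < t -> exists2 x, K x & forall i, g x i <= t) ->
  exists2 x, K x & forall i, g x i <= v.
Proof.
move=> H.
have [[i0 _]|nI] := pselect (exists i : J, True); last first.
  have [|x Kx _] := H (v + 1); first by rewrite ltrDl.
  by exists x => // i; case: nI; exists i.
pose F t := K `&` [set x | forall i, g x i <= t].
have [|||x Hx] := @compact_chain K [set F t | t in [set t | v < t]] compactK.
- by exists (F (v + 1)); exists (v + 1) => //=; rewrite ltrDl.
- move=> _ _ [s _ <-] [t _ <-]; have [st|ts] := leP s t; [left|right].
    by move=> x [Kx gx]; split=> // i; exact: le_trans (gx i) _.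
  by move=> x [Kx gx]; split=> // i; exact: le_trans (gx i) (ltW _).
- move=> _ [t vt <-]; split; first exact: (@closed_dom (fun=> t) i0).
    by move=> x [].
  by have [x Kx gx] := H t vt; exists x.
have FH t : v < t -> F t x by move=> vt; apply: Hx; exists t.
exists x => [|i]; first by case: (FH (v + 1)); rewrite ?ltrDl.
by apply/ler_addgt0Pr => e e0; case: (FH (v + e)); rewrite ?ltrDl.
Qed.

Lemma compact_pareto_minimal (x0 : T) : K x0 ->
  exists x, [/\ K x, forall i, g x i <= g x0 i & forall x', K x' ->
    (forall i, g x' i <= g x i) -> forall i, g x i <= g x' i].
Proof.
move=> Kx0.
have [[i0 _]|nI] := pselect (exists i : J, True); last first.
  by exists x0; split=> // x' _ _ i; case: nI; exists i.
pose D x := K x /\ forall i, g x i <= g x0 i.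
have Dx0 : D x0 by [].
(* The order is reversed, so the maximal elements given by Zorn's lemma are minimal for [g]. It is
   only a preorder, as distinct points may share the same values. *)
pose r (a b : {x | D x}) := `[< forall i, g (sval b) i <= g (sval a) i >].
have [//| | |[x [Kx gx0]] Hx] := @ZL_preorder _ (exist _ x0 Dx0) r.
- by move=> a; apply/asboolP => i.
- by move=> b a c /asboolP ab /asboolP bc; apply/asboolP => i; exact: le_trans (ab i).
- move=> A Atot.
  have [[a Aa]|nA] := pselect (A !=set0); last first.
    by exists (exist _ x0 Dx0) => s As; case: nA; exists s.
  pose F (a : {x | D x}) := K `&` [set x | forall i, g x i <= g (sval a) i].
  have [|||x Hx] := @compact_chain K [set F a | a in A] compactK.
  + by exists (F a); exists a.
  + move=> _ _ [b Ab <-] [c Ac <-]; case: (Atot _ _ Ab Ac) => /asboolP bc.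
      by right=> x [Kx gx]; split=> // i; exact: le_trans (gx i) (bc i).
    by left=> x [Kx gx]; split=> // i; exact: le_trans (gx i) (bc i).
  + move=> _ [b Ab <-]; split; first exact: (@closed_dom (g (sval b)) i0).
      by move=> x [].
    by exists (sval b); split=> //; case: (svalP b).
  have FH b : A b -> F b x by move=> Ab; apply: Hx; exists b.
  have Dx : D x.
    have [Kx gx] := FH a Aa; split=> // i; apply: le_trans (gx i) _.
    by case: (svalP a).
  by exists (exist _ x Dx) => b /FH[_ gx]; apply/asboolP.
exists x; split=> // x' Kx' H.
have Dx' : D x' by split=> // i; exact: le_trans (H i) (gx0 i).
by have /(_ (asboolT H)) /asboolP := Hx (exist _ x' Dx').
Qed.

End compact_orders.

(** * Continuity, closed sets and Borel measurability *)

Section continuity.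
Variable R : realType.

Lemma linear_mx_continuous m n (V : normedModType R)
  (f : {linear 'M[R]_(m, n) -> V}) : continuous f.
Proof.
have -> : f = (fun M => \sum_i \sum_j M i j *: f (delta_mx i j)) :> (_ -> _).
  apply/funext => M; rewrite [in LHS](matrix_sum_delta M) linear_sum.
  apply: eq_bigr => i _; rewrite linear_sum; apply: eq_bigr => j _.
  by rewrite linearZ.
apply: continuous_big => [|i _]; first exact: add_continuous.
apply: continuous_big => [|j _]; first exact: add_continuous.
by move=> M; apply: continuousZr_tmp; exact: coord_continuous.
Qed.

Lemma affine_mx_continuous m n (V : normedModType R) (f : 'M[R]_(m, n) -> V) :
  affine_map f -> continuous f.
Proof.
move=> [g [b /funext ->]] v.
by apply: continuousD; [exact: linear_mx_continuous | exact: cst_continuous].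
Qed.

Lemma mulmx_continuous (T : topologicalType) m n p (A : 'M[R]_(m, n))
    (f : T -> 'M[R]_(n, p)) :
  continuous f -> continuous (fun x => A *m f x).
Proof.
move=> cf x; apply: (@continuous_comp _ _ _ f (mulmx A)); first exact: cf.
exact: (@linear_mx_continuous _ _ _ (mulmx A)).
Qed.

Lemma mulmxr_continuous (T : topologicalType) m n p (A : 'M[R]_(n, p))
    (f : T -> 'M[R]_(m, n)) :
  continuous f -> continuous (fun x => f x *m A).
Proof.
move=> cf x; apply: (@continuous_comp _ _ _ f (mulmxr A)); first exact: cf.
exact: (@linear_mx_continuous _ _ _ (mulmxr A)).
Qed.

Lemma dotcV_continuous (T : topologicalType) n (d : 'cV[R]_n) (f : T -> 'cV[R]_n) :
  continuous f -> continuous (fun x => dotcV d (f x)).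
Proof.
move=> cf x; apply: (@continuous_comp _ _ _ (fun x => d^T *m f x) (fun M => M 0 0)).
  exact: mulmx_continuous.
exact: coord_continuous.
Qed.

Lemma dotcVC n (u v : 'cV[R]_n) : dotcV u v = dotcV v u.
Proof. by rewrite /dotcV -[v^T *m u]trmxK [RHS]mxE trmx_mul trmxK. Qed.

Lemma closed_le_fun (T : topologicalType) (f g : T -> R) :
  continuous f -> continuous g -> closed [set x | f x <= g x].
Proof.
move=> cf cg; have -> : [set x | f x <= g x] = (g \- f) @^-1` [set t | 0 <= t].
  by apply/seteqP; split=> x /=; rewrite subr_ge0.
apply: preimage_closed; last exact: closed_ge.
by move=> x _; apply: continuousB; [exact: cg | exact: cf].
Qed.

Lemma closed_le_cV (T : topologicalType) n (f g : T -> 'cV[R]_n) :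
  continuous f -> continuous g -> closed [set x | le_cV (f x) (g x)].
Proof.
move=> cf cg; have -> : [set x | le_cV (f x) (g x)] =
    \bigcap_i [set x | f x i 0 <= g x i 0].
  by apply/seteqP; split=> [x + i _|x + i]; exact.
apply: closed_bigI => i _; apply: closed_le_fun => x.
- apply: (@continuous_comp _ _ _ f (fun v => v i 0)); first exact: cf.
  exact: coord_continuous.
- apply: (@continuous_comp _ _ _ g (fun v => v i 0)); first exact: cg.
  exact: coord_continuous.
Qed.

Lemma measurable_closed_cV n (A : set 'cV[R]_n) :
  closed A -> measurable (A : set (borel_cV R n)).
Proof.
move=> clA; rewrite -[A]setCK; apply: measurableC; apply: sub_sigma_algebra.
exact: closed_openC.
Qed.

Lemma continuous_measurable_cV m n (f : 'cV[R]_m -> 'cV[R]_n) :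
  continuous f -> measurable_fun [set: borel_cV R m] (f : borel_cV R m -> borel_cV R n).
Proof.
move=> cf; apply: (measurability (@open 'cV[R]_n : set (set (borel_cV R n)))) => //.
move=> _ [V oV <-]; rewrite setTI; apply: sub_sigma_algebra.
by apply: open_comp => // x _; exact: cf.
Qed.

Lemma measurable_patch m n (A : set (borel_cV R m)) (f g : borel_cV R m -> borel_cV R n) :
  measurable A -> measurable_fun setT f -> measurable_fun setT g ->
  measurable_fun setT (fun x => if `[< A x >] then f x else g x).
Proof.
move=> mA mf mg; apply: measurable_fun_ifT => //.
apply: (measurable_fun_bool true); rewrite setTI.
suff -> : (fun x => `[< A x >]) @^-1` [set true] = A by [].
by apply/seteqP; split=> x /= /asboolP.
Qed.

End continuity.

(** * Measurable selection of an optimal solution *)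

Section selection.
Variables (R : realType) (m n : nat) (B : 'M[R]_(m, n)) (d : 'cV[R]_n).
Implicit Types (b : 'cV[R]_m) (S T : {set 'I_m}) (y : 'cV[R]_n).

Definition basic_feasible S : set 'cV[R]_m :=
  [set b | le_cV (B *m (basic_sol B S *m b)) b].

Definition basic_optimal S : set 'cV[R]_m :=
  basic_feasible S `&` [set b | forall T, basic_feasible T b ->
    dotcV d (basic_sol B S *m b) <= dotcV d (basic_sol B T *m b)].

Lemma closed_basic_feasible S : closed (basic_feasible S).
Proof.
have cid : continuous (fun b : 'cV[R]_m => b) by move=> b; exact: cvg_id.
by apply: closed_le_cV => //; apply: mulmx_continuous; exact: mulmx_continuous.
Qed.

(** Feasibility and cost comparison are closed conditions on [b], but the implication complements
    the former, so a finite Boolean combination of closed sets results. *)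
Lemma measurable_basic_optimal S :
  measurable (basic_optimal S : set (borel_cV R m)).
Proof.
have mF T := measurable_closed_cV (@closed_basic_feasible T).
apply: measurableI => //.
pose cheaper T := [set b | dotcV d (basic_sol B S *m b) <= dotcV d (basic_sol B T *m b)].
have -> : [set b | forall T, basic_feasible T b ->
    dotcV d (basic_sol B S *m b) <= dotcV d (basic_sol B T *m b)] =
    \bigcap_(T in [set: {set 'I_m}]) (~` basic_feasible T `|` cheaper T).
  apply/seteqP; split=> b.
    by move=> H T _; have [/H|] := pselect (basic_feasible T b); [right|left].
  by move=> H T bT; have [|] := H T I.
apply: fin_bigcap_measurable => // T _; apply: measurableU.
  by apply: measurableC; exact: mF.
apply: measurable_closed_cV; apply: closed_le_fun;
  by apply: dotcV_continuous; apply: mulmx_continuous => ?; exact: cvg_id.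
Qed.

(** Ties go to the first optimal [S] in a fixed enumeration, which makes the choice a finite case
    split over Borel sets. The default 0 occurs when no basic solution is feasible. *)
Definition lp_sol b : 'cV[R]_n :=
  foldr (fun S y => if `[< basic_optimal S b >] then basic_sol B S *m b else y)
    0 (enum {set 'I_m}).

Lemma measurable_lp_sol :
  measurable_fun [set: borel_cV R m] (lp_sol : borel_cV R m -> borel_cV R n).
Proof.
rewrite /lp_sol; elim: (enum _) => [|S s IH] /=; first exact: measurable_cst.
apply: measurable_patch => //; first exact: measurable_basic_optimal.
apply: continuous_measurable_cV; apply: mulmx_continuous => ?; exact: cvg_id.
Qed.

Lemma lp_sol_cases b :
  (lp_sol b = 0 /\ forall S, ~ basic_optimal S b) \/
  exists2 S, basic_optimal S b & lp_sol b = basic_sol B S *m b.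
Proof.
rewrite /lp_sol; have : forall S, S \in enum {set 'I_m} by move=> S; rewrite mem_enum.
(* The enumeration is generalised to an arbitrary list for the induction. *)
suff: forall s, let y := foldr (fun S y => if `[< basic_optimal S b >]
        then basic_sol B S *m b else y) 0 s in
    (y = 0 /\ forall S, S \in s -> ~ basic_optimal S b) \/
    exists2 S, basic_optimal S b & y = basic_sol B S *m b.
  move=> /(_ (enum {set 'I_m}))[[-> H] all|]; last by right.
  by left; split=> // S; exact: H.
elim=> [|S s IH] /=; first by left.
case: asboolP => [bS|nbS]; first by right; exists S.
case: IH => [[-> H]|]; last by right.
by left; split=> // T; rewrite inE => /predU1P[->|/H].
Qed.

(** By Farkas' lemma, this amounts to feasibility of the dual linear program. *)
Hypothesis dual : forall w, le_cV (B *m w) 0 -> 0 <= dotcV d w.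

Lemma lp_sol_basic b y : le_cV (B *m y) b ->
  exists2 S, basic_optimal S b & lp_sol b = basic_sol B S *m b.
Proof.
move=> By; have [[_ H]|//] := lp_sol_cases b; exfalso.
have [S0 [S0b _]] := basic_sol_opt dual By.
have /(@arg_minP _ _ _ S0 (fun S => `[< basic_feasible S b >])
  (fun S => dotcV d (basic_sol B S *m b))) : `[< basic_feasible S0 b >] by apply/asboolP.
case=> S /asboolP Sb Smin; apply: (H S); split=> // T Tb.
by apply: Smin; exact/asboolP.
Qed.

Lemma lp_solP b y : le_cV (B *m y) b ->
  le_cV (B *m lp_sol b) b /\ dotcV d (lp_sol b) <= dotcV d y.
Proof.
move=> By; have [S [Sb Sopt] ->] := lp_sol_basic By; split=> //.
have [T [Tb Ty]] := basic_sol_opt dual By.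
exact: le_trans (Sopt _ Tb) Ty.
Qed.

(** The selection [lp_sol] may jump, but its value is the minimum over the feasible basic solutions.
    The sublevel set is thus a finite union over [S] of closed sets, where optimality of [S] need
    not be imposed. *)
Lemma closed_lp_sol_le (T : topologicalType) (K : set T) (f : T -> 'cV[R]_m)
    (c : T -> R) (t : R) :
  closed K -> continuous f -> continuous c ->
  (forall x, K x -> exists y, le_cV (B *m y) (f x)) ->
  closed (K `&` [set x | c x + dotcV d (lp_sol (f x)) <= t]).
Proof.
move=> clK cf cc feas.
have -> : K `&` [set x | c x + dotcV d (lp_sol (f x)) <= t] =
    K `&` \bigcup_(S in [set: {set 'I_m}]) (f @^-1` basic_feasible S `&`
      [set x | c x + dotcV d (basic_sol B S *m f x) <= t]).
  apply/seteqP; split=> x [Kx Hx]; split=> //; have [y By] := feas _ Kx.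
    by have [S [Sb _] eS] := lp_sol_basic By; exists S => //; rewrite /= -eS.
  case: Hx => S _ [Sb]; apply: le_trans.
  by rewrite lerD2l; case: (lp_solP Sb).
apply: closedI => //; apply: closed_bigcup => [|S _]; first exact: finite_finset.
apply: closedI.
  by apply: preimage_closed => [x _|]; [exact: cf | exact: closed_basic_feasible].
apply: closed_le_fun => x; last exact: cvg_cst.
apply: (@continuousD _ R^o _ c); first exact: cc.
by apply: dotcV_continuous; exact: mulmx_continuous.
Qed.

Lemma decision_rule_lp_sol L (U : set 'cV[R]_L) (f : 'cV[R]_L -> 'cV[R]_m) :
  compact U -> continuous f ->
  decision_rule (fun z => if `[< U z >] then lp_sol (f z) else 0).
Proof.
move=> cU cf; split.
  apply: measurable_patch; last exact: measurable_cst.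
    by apply: measurable_closed_cV; apply: compact_closed cU; exact: norm_hausdorff.
  apply: (measurableT_comp measurable_lp_sol); exact: continuous_measurable_cV.
move=> K _.
(* All values of the rule lie in this finite union of compact sets, whichever [S] is selected at
   each point. *)
pose V := [set 0] `|` \big[setU/set0]_(S : {set 'I_m})
  ((fun z => basic_sol B S *m f z) @` U).
have /compact_bounded : compact V.
  apply: compactU; first exact: compact_set1.
  apply: bigsetU_compact => S _; apply: continuous_compact => //.
  by apply: continuous_subspaceT; exact: mulmx_continuous.
apply: sub_boundedr => W WV _ [z _ <-]; apply: WV.
case: asboolP => [Uz|_]; last by left.
have [[-> _]|[S _ ->]] := lp_sol_cases (f z); first by left.
by right; rewrite -bigcup_seq; exists S; [rewrite /= mem_index_enum | exists z].
Qed.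

End selection.

(** * Norm bounds and translation of decision rules *)

Section boundedness.
Variable R : realType.

Lemma bounded_set_norm_le (V : normedModType R) (A : set V) :
  bounded_set A -> exists M : R, forall v, A v -> `|v| <= M.
Proof. by move=> [M [_ HM]]; exists (M + 1); apply: HM; rewrite ltrDl. Qed.

Lemma entry_le_norm m n (v : 'M[R]_(m, n)) i j : `|v i j| <= `|v|.
Proof.
by rewrite [leRHS]/Num.Def.normr/= mx_normrE; apply: (le_bigmax _ _ (i, j)).
Qed.

Lemma dotcV_le_norm n (d v : 'cV[R]_n) :
  `|dotcV d v| <= (\sum_i `|d i 0|) * `|v|.
Proof.
rewrite /dotcV mxE mulr_suml; apply: le_trans (ler_norm_sum _ _ _) _.
by apply: ler_sum => i _; rewrite mxE normrM ler_wpM2l ?entry_le_norm.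
Qed.

Lemma decision_ruleD L n (y : 'cV[R]_L -> 'cV[R]_n) (w : 'cV[R]_n) :
  decision_rule y -> decision_rule (fun z => y z + w).
Proof.
move=> [my by_]; split.
  apply: (measurableT_comp (continuous_measurable_cV (f := fun v => v + w) _) my).
  by move=> v; apply: continuousD; [exact: cvg_id | exact: cst_continuous].
move=> K /by_ [M [Mr HM]]; exists (M + `|w|); split; first exact: num_real.
move=> N MN _ [z Kz <-]; apply: le_trans (ler_normD _ _) _.
rewrite -lerBrDr; apply: (HM (N - `|w|)); last by exists z.
by rewrite ltrBrDr.
Qed.

End boundedness.

(** * The recourse program of the two-stage problem *)

Section recourse.
Variables (R : realType) (L nx ny m : nat) (P : problem R L nx ny m).
Hypotheses (compactU : compact (pU P)) (affineA : affine_map (pA P))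
  (affiner : affine_map (pr P)) (affinec : affine_map (pc P)).
Implicit Types (x : 'cV[R]_nx) (y : 'cV[R]_L -> 'cV[R]_ny) (z : 'cV[R]_L).

Definition slack x z : 'cV[R]_m := pr P z - pA P z *m x.

Lemma slackP x z (v : 'cV[R]_ny) :
  le_cV (pA P z *m x + pB P *m v) (pr P z) <-> le_cV (pB P *m v) (slack x z).
Proof.
by split=> H i; have := H i; rewrite [(pA P z *m x + _) i 0]mxE
  [slack x z i 0]mxE [(- (pA P z *m x)) i 0]mxE lerBrDl.
Qed.

(** Continuity in [x] yields closed sublevel sets; continuity in [z], proved next, yields an
    admissible decision rule. *)
Lemma slack_continuousl z : continuous (slack ^~ z).
Proof.
move=> x; apply: (@continuousB _ _ _ (fun=> pr P z)); first exact: cst_continuous.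
by apply: mulmx_continuous => ?; exact: cvg_id.
Qed.

Lemma slack_continuousr x : continuous (slack x).
Proof.
move=> z; apply: (@continuousB _ _ _ (pr P)); first exact: affine_mx_continuous.
by apply: mulmxr_continuous; exact: affine_mx_continuous.
Qed.

Lemma objective_bounded x y : decision_rule y ->
  exists M, forall z, pU P z -> objective P x y z <= M.
Proof.
move=> [_ /(_ _ compactU)/bounded_set_norm_le[M2 H2]].
have cc : continuous ((fun z => dotcV (pc P z) x) : _ -> R^o).
  under eq_fun do rewrite dotcVC.
  by apply: dotcV_continuous; exact: affine_mx_continuous.
have /compact_bounded/bounded_set_norm_le[M1 H1] :=
  continuous_compact (continuous_subspaceT cc) compactU.
exists (M1 + (\sum_i `|pd P i 0|) * M2) => z Uz; apply: lerD.
  by apply: le_trans (ler_norm _) (H1 _ _); exists z.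
apply: le_trans (ler_norm _) _; apply: le_trans (dotcV_le_norm _ _) _.
by rewrite ler_wpM2l ?sumr_ge0//; apply: H2; exists z.
Qed.

(** Adding a large multiple of a cost-decreasing recession direction to a feasible rule keeps it
    feasible and lowers the objective uniformly on the uncertainty set, eventually below [OPT]. *)
Lemma recession_cost_ge0 (w : 'cV[R]_ny) :
  ARF_stage1 P !=set0 -> OPT P \is a fin_num ->
  le_cV (pB P *m w) 0 -> 0 <= dotcV (pd P) w.
Proof.
move=> [x [y [dy Hy]]] finOPT Bw; rewrite leNgt; apply/negP => dw.
have [M HM] := objective_bounded x dy.
(* Chosen so that an objective bounded by [M] drops to at most [OPT - 1]. *)
pose t := (`|M - fine (OPT P)| + 1) / - dotcV (pd P) w.
have t0 : 0 <= t by rewrite divr_ge0 ?addr_ge0// oppr_ge0 ltW.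
have tw : t * dotcV (pd P) w = - (`|M - fine (OPT P)| + 1).
  by rewrite /t invrN mulrN mulNr divfK// lt_eqF.
have : (OPT P <= (fine (OPT P) - 1)%:E)%E.
  apply: (@le_trans _ _ (worst_case P x (fun z => y z + t *: w))).
    apply: ereal_inf_lbound; exists x, (fun z => y z + t *: w); split=> //.
    split; first exact: decision_ruleD.
    move=> z Uz; apply/slackP => i.
    have /slackP/(_ i) := Hy z Uz; apply: le_trans.
    rewrite mulmxDr -scalemxAr [leLHS]mxE [X in _ + X]mxE gerDl.
    by rewrite mulr_ge0_le0//; have := Bw i; rewrite [leRHS]mxE.
  apply: ge_ereal_sup => _ [z Uz <-]; rewrite lee_fin /objective dotcVD dotcVZ tw.
  have := HM z Uz; rewrite /objective; have := ler_norm (M - fine (OPT P)); lra.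
rewrite -[X in (X <= _)%E](fineK finOPT) lee_fin; lra.
Qed.

End recourse.

Theorem theorem1 (R : realType) (L nx ny m : nat) (P : problem R L nx ny m)
  (compactU : compact (pU P))
  (convexU : convex_set (pU P))
  (relintU : relative_interior (pU P) !=set0)
  (affineA : affine_map (pA P))
  (affiner : affine_map (pr P))
  (affinec : affine_map (pc P))
  (feasible : ARF_stage1 P !=set0)
  (finiteOPT : OPT P \is a fin_num)
  (compactX : compact (ARF_stage1 P)) :
  exists x : 'cV[R]_nx, PARO_stage1 P x.
Proof.
have dual w := @recession_cost_ge0 _ _ _ _ _ P compactU affinec w feasible finiteOPT.
pose X := ARF_stage1 P.
(* Indexing by the subtype restricts the pointwise order to scenarios in the uncertainty set. *)
pose g x (z : {z | pU P z}) :=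
  dotcV (pc P (sval z)) x + dotcV (pd P) (lp_sol (pB P) (pd P) (slack P x (sval z))).
have g_le x y (z : {z | pU P z}) : ARF P x y -> g x z <= objective P x y (sval z).
  case: z => z Uz [_ /(_ z Uz)/slackP H]; rewrite /g/= lerD2l.
  by have [] := lp_solP dual H.
have closedX z t : closed (X `&` [set x | g x z <= t]).
  apply: (closed_lp_sol_le dual).
  - by apply: compact_closed compactX; exact: norm_hausdorff.
  - exact: slack_continuousl.
  - by apply: dotcV_continuous => ?; exact: cvg_id.
  - by move=> x [y [_ H]]; exists (y (sval z)); apply/slackP/H; exact: svalP.
pose sol x z := if `[< pU P z >] then lp_sol (pB P) (pd P) (slack P x z) else 0.
have objE x z : objective P x (sol x) (sval z) = g x z.
  by rewrite /objective /sol asboolT//; exact: svalP.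
have solP x : X x -> ARF P x (sol x).
  move=> [y [_ H]]; split.
    by apply: decision_rule_lp_sol => //; exact: slack_continuousr.
  move=> z Uz; apply/slackP; rewrite /sol asboolT//.
  by have /slackP/(lp_solP dual)[] := H z Uz.
(* For every [t] above [OPT] some feasible pair has worst case below [t], and [g] bounds its
   objective from below. *)
have [|x0 Xx0 x0opt] := compact_minimax_attained compactX closedX (v := fine (OPT P)).
  move=> t; rewrite -lte_fin fineK// => /ereal_inf_lt[_ [x [y [xy ->]]] wt].
  exists x => [|z]; first by exists y.
  apply: le_trans (g_le _ _ _ xy) _; rewrite -lee_fin; apply: le_trans (ltW wt).
  by apply: ereal_sup_ubound; exists (sval z) => //; exact: svalP.
have [x [Xx xx0 xmin]] := compact_pareto_minimal compactX closedX Xx0.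
exists x, (sol x); split.
  split; first exact: solP.
  move=> z Uz; rewrite (objE x (exist _ z Uz)) -(fineK finiteOPT) lee_fin.
  exact: le_trans (xx0 _) (x0opt _).
move=> [x' [y' [[x'y' _] le_obj [z Uz]]]].
(* A dominating pair gives [g x' <= g x] everywhere; minimality of [x] then gives [g x <= g x'],
   which is at most the objective of [(x', y')], so no strict gain at [z] is possible. *)
rewrite (objE x (exist _ z Uz)); apply/negP; rewrite -leNgt.
apply: le_trans (g_le _ _ (exist _ z Uz) x'y').
apply: xmin => [|{Uz}z']; first by exists y'.
by apply: le_trans (g_le _ _ _ x'y') _; rewrite -objE; apply: le_obj; exact: svalP.
Qed.
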